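(* Let $p\geq1$, let $\varrho:\mathscr{P}(\mathbb{R})\to\mathbb{R}$ be a functional and let $\mathscr{M}\subset\mathscr{P}_p(\mathbb{R})$. For $N\in\mathbb{N}$ and $\boldsymbol\xi=(\xi^1,\dots,\xi^N)\in\mathbb{R}^N$ let $P_N^{\boldsymbol\xi}=\frac1N\sum_{i=1}^N\delta_{\xi^i}$ denote the empirical distribution, and define $\widehat\varrho_N:\mathbb{R}^N\to\mathbb{R}$ by $\widehat\varrho_N(\boldsymbol\xi)=\varrho(P_N^{\boldsymbol\xi})$. Fix $N\in\mathbb{N}$ and assume there is a constant $L>0$ such that $$|\varrho(P_N^{\boldsymbol\xi})-\varrho(P_N^{\widehat{\boldsymbol\xi}})|\leq\frac LN\sum_{k=1}^N c_p(\xi^k,\widehat\xi^k)|\xi^k-\widehat\xi^k|\quad\text{for all }\boldsymbol\xi,\widehat{\boldsymbol\xi}\in\mathbb{R}^N.$$ Then $$\mathsf{d}_K\big(P^{\otimes N}\circ\widehat\varrho_N^{-1},\,Q^{\otimes N}\circ\widehat\varrho_N^{-1}\big)\leq L\,\mathsf{d}_{FM,p}(P,Q)<+\infty\quad\text{for all }P,Q\in\mathscr{M}.$$ If the assumption holds (with the same $L$) for all $N\in\mathbb{N}$, then this inequality holds for all $N\in\mathbb{N}$. In particular, when $p=1$, $\mathsf{d}_K\big(P^{\otimes N}\circ\widehat\varrho_N^{-1},Q^{\otimes N}\circ\widehat\varrho_N^{-1}\big)\leq L\,\mathsf{d}_K(P,Q)<+\infty$ for all $P,Q\in\mathscr{M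}$.
   Context: $\mathscr{P}(\mathbb{R})$ is the set of Borel probability measures on $\mathbb{R}$. For $p\geq1$, $c_p(\xi,\tilde\xi)=\max\{1,|\xi|,|\tilde\xi|\}^{p-1}$; $\mathcal{F}_p(\mathbb{R})$ is the set of $\psi:\mathbb{R}\to\mathbb{R}$ with $|\psi(\xi)-\psi(\tilde\xi)|\leq c_p(\xi,\tilde\xi)|\xi-\tilde\xi|$ for all $\xi,\tilde\xi$; the Fortet–Mourier metric is $\mathsf{d}_{FM,p}(P,Q)=\sup_{\psi\in\mathcal{F}_p(\mathbb{R})}|\int\psi\,dP-\int\psi\,dQ|$, and the Kantorovich metric is $\mathsf{d}_K=\mathsf{d}_{FM,1}$ (supremum over $1$-Lipschitz functions). $\mathscr{P}_p(\mathbb{R})=\{P\in\mathscr{P}(\mathbb{R}):\mathsf{d}_{FM,p}(P,\delta_0)<+\infty\}$, with $\delta_0$ the Dirac measure at $0$. $P^{\otimes N}$ is the $N$-fold product measure on $\mathbb{R}^N$ and $P^{\otimes N}\circ\widehat\varrho_N^{-1}$ is the law of $\widehat\varrho_N(\xi^1,\dots,\xi^N)$ when $\xi^1,\dots,\xi^N$ are i.i.d. with law $P$. *)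

(* Defs.v *)
From HB Require Import structures.
From mathcomp Require Import all_boot all_order all_algebra.
From mathcomp Require Import all_classical all_reals all_analysis.
Set Implicit Arguments. Unset Strict Implicit. Unset Printing Implicit Defensive.
Import Order.TTheory GRing.Theory Num.Theory.
Import numFieldNormedType.Exports.
Local Open Scope classical_set_scope.
Local Open Scope ring_scope.

Section defs.
Context {R : realType}.

Definition cp (p : R) (x y : R) : R :=
  (Num.max 1 (Num.max `|x| `|y|)) `^ (p - 1).

Definition FMclass (p : R) : set (R -> R) :=
  [set psi | forall x y : R, `|psi x - psi y| <= cp p x y * `|x - y|].

Definition dFM (p : R) (mu nu : set R -> \bar R) : \bar R :=
  ereal_sup [set `| (\int[mu]_x (psi x)%:E) - (\int[nu]_x (psi x)%:E) |%E
            | psi in FMclass p].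

Definition dK (mu nu : set R -> \bar R) : \bar R := dFM 1 mu nu.

Definition Pp (p : R) : set (probability R R) :=
  [set P | (dFM p P (@dirac _ R 0%R R) < +oo)%E].

Definition empirical (N : nat) (xi : N.-tuple R) : set R -> \bar R :=
  fun A => (((N%:R)^-1)%:E * \sum_(i < N) @dirac _ R (tnth xi i) R A)%E.

Definition rhohat (rho : (set R -> \bar R) -> R) (N : nat) (xi : N.-tuple R) : R :=
  rho (empirical xi).

(* mu is the N-fold product measure P^{(x)N} on R^N = N.-tuple R:
   it agrees with the product of P on all measurable rectangles
   (this determines the product measure uniquely). *)
Definition is_prod_measure (N : nat) (P : set R -> \bar R)
    (mu : set (N.-tuple R) -> \bar R) : Prop :=
  forall A : 'I_N -> set R, (forall i, measurable (A i)) ->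
    mu [set x | forall i, A i (tnth x i)] = (\prod_(i < N) P (A i))%E.

End defs.

(* Main.v *)
(* The supremum defining [dK] runs over 1-Lipschitz [psi]; for such [psi], [psi \o rhohat] is
   Lipschitz with constant [L / N] for the additive cost [\sum_k cost p x_k y_k]. Such a function
   [g] is handled one coordinate at a time, by induction on the number of coordinates: by Fubini,
     \int g dP^(n+1) - \int g dQ^(n+1) = (\int h_P dP - \int h_P dQ) + \int (h_P - h_Q) dQ,
   where [h_P x = \int g (x :: t) dP^n(t)] and likewise [h_Q]. A multiple of [h_P] lies in the
   Fortet-Mourier class, and [h_P - h_Q] is bounded by the induction hypothesis on each slice. *)
Require Import Defs.
From HB Require Import structures.
From mathcomp Require Import all_boot all_order all_algebra.
From mathcomp Require Import all_classical all_reals all_analysis.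
From mathcomp Require Import measurable_realfun ring lra.
Import Order.TTheory GRing.Theory Num.Theory.
Import numFieldNormedType.Exports.
Local Open Scope classical_set_scope.
Local Open Scope ring_scope.

(** * The weighted distance on the real line *)

Section cost.
Context {R : realType} (p : R).
Hypothesis p1 : 1 <= p.

Definition cost (x y : R) : R := cp p x y * `|x - y|.

Let q0 : 0 <= p - 1. Proof. by rewrite subr_ge0. Qed.

Lemma cp_ge1 x y : 1 <= cp p x y.
Proof.
rewrite /cp; have /(ler_powR) : 1 <= Num.max 1 (Num.max `|x| `|y|).
  by rewrite le_max lexx.
by move=> /(_ _ _ q0); rewrite powRr0.
Qed.

Lemma cost_ge0 x y : 0 <= cost x y.
Proof. by rewrite mulr_ge0// (le_trans _ (cp_ge1 x y)). Qed.

Lemma costC x y : cost x y = cost y x.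
Proof. by rewrite /cost /cp distrC (maxC `|x|). Qed.

Lemma costxx x : cost x x = 0.
Proof. by rewrite /cost subrr normr0 mulr0. Qed.

Lemma cost0 x : cost x 0 = (Num.max 1 `|x|) `^ (p - 1) * `|x|.
Proof. by rewrite /cost /cp normr0 subr0 (max_l (normr_ge0 x)). Qed.

Lemma measurable_cost y : measurable_fun setT (cost ^~ y).
Proof.
have mmax : measurable_fun setT (fun x : R => Num.max 1 (Num.max `|x| `|y|)).
  by apply: measurable_maxr => //; apply: measurable_maxr.
have mcp : measurable_fun setT (cp p ^~ y).
  exact: (measurableT_comp (@measurable_powR R (p - 1)) mmax).
apply: measurable_funM => //.
by apply: measurableT_comp => //; exact: measurable_funB.
Qed.

Lemma cost_dense x (e : R) : 0 < e -> exists k : rat, cost x (ratr k) < e.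
Proof.
(* [K] bounds the weight [cp p x y] for all [y] within distance 1 of [x]; the rational is then taken
   less than [Num.min 1 (e / K)] to the right of [x]. *)
move=> e0; pose K : R := (`|x| + 1) `^ (p - 1).
have K0 : 0 < K by rewrite powR_gt0// ltr_wpDl.
have : x < x + Num.min 1 (e / K) by rewrite ltrDl lt_min ltr01 divr_gt0.
move=> /rat_in_itvoo[k]; rewrite in_itv/= -ltrBlDl lt_min => /andP[xk /andP[k1 kK]].
exists k; rewrite /cost distrC gtr0_norm ?subr_gt0//.
have : cp p x (ratr k) <= K.
  apply: ge0_ler_powR => //.
  - by rewrite nnegrE le_max ler01.
  - by rewrite nnegrE addr_ge0.
  rewrite !ge_max lerDr normr_ge0 lerDl ler01/=.
  have := ler_normD (ratr k - x) x; rewrite subrK => /le_trans; apply.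
  by rewrite addrC lerD2l gtr0_norm ?subr_gt0// ltW.
move=> cK; apply: (@le_lt_trans _ _ (K * (ratr k - x))).
  by rewrite ler_wpM2r// subr_ge0 ltW.
by rewrite mulrC -ltr_pdivlMr.
Qed.

(** Bernoulli's inequality [(1 + u) ^+ n >= 1 + n%:R * u] at [u = t - 1]. *)
Lemma bernoulli_expr (t : R) n : 0 <= t <= 1 -> 1 - t ^+ n <= n%:R * (1 - t).
Proof.
move=> /andP[t0 t1]; elim: n => [|n ih]; first by rewrite expr0 subrr mul0r.
have /andP[tn0 tn1] : 0 <= t ^+ n <= 1 by rewrite exprn_ge0// exprn_ile1.
rewrite exprS -natr1; nra.
Qed.

(** With [t = a / b <= 1], everything reduces to [1 - t ^ (p - 1) <= 1 - t ^+ n <= n%:R * (1 - t)]: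
    passing to a natural exponent lets Bernoulli's inequality stand in for a derivative. *)
Lemma powR_lip (a b : R) n : 1 <= a -> a <= b -> p - 1 <= n%:R ->
  a * (b `^ (p - 1) - a `^ (p - 1)) <= n%:R * b `^ (p - 1) * (b - a).
Proof.
move=> a1 ab qn.
have a0 : 0 < a by lra.
have b0 : 0 < b by lra.
pose t := a / b.
have t0 : 0 < t by rewrite divr_gt0.
have t1 : t <= 1 by rewrite ler_pdivrMr// mul1r.
have aE : a = t * b by rewrite divfK// gt_eqF.
have tq : 1 - t `^ (p - 1) <= n%:R * (1 - t).
  apply: le_trans (@bernoulli_expr t n _); last by rewrite t1 ltW.
  rewrite lerD2l lerN2 -powR_mulrn ?(ltW t0)//.
  by apply: ger_powR; rewrite ?t0.
have B0 : 0 < b `^ (p - 1) by exact: powR_gt0.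
have -> : a `^ (p - 1) = t `^ (p - 1) * b `^ (p - 1).
  by rewrite -powRM ?(ltW t0) ?(ltW b0)// -aE.
apply: (@le_trans _ _ (a * (b `^ (p - 1) * (n%:R * (1 - t))))).
  rewrite ler_pM2l//; have : 0 <= b `^ (p - 1) by exact: ltW.
  move: tq; nra.
have -> : b - a = b * (1 - t) by rewrite {1}aE; ring.
rewrite aE.
have : 0 <= b * b `^ (p - 1) * n%:R * (1 - t).
  by rewrite !mulr_ge0 ?subr_ge0 ?(ltW b0) ?(ltW B0).
nra.
Qed.

(* Hence a multiple of [cost p ^~ 0], which has growth [|x| ^ p], lies in [FMclass p]: this is
   what gives the measures of [Pp p] a finite moment of order [p]. *)
Lemma cost0_lip : exists2 K : R, 0 < K &
  forall x y, `|cost x 0 - cost y 0| <= K * cost x y.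
Proof.
pose n := (Num.truncn (p - 1)).+1.
have qn : p - 1 <= n%:R by rewrite ltW// truncnS_gt.
exists n.+1%:R => //.
suff H x y : `|x| <= `|y| -> `|cost x 0 - cost y 0| <= n.+1%:R * cost x y.
  move=> x y; have [/H//|/ltW/H] := leP `|x| `|y|.
  by rewrite distrC (costC y x).
move=> xy; rewrite !cost0 /cost /cp (max_r xy).
set a := `|x|; set b := `|y|.
have dxy : b - a <= `|x - y| by rewrite distrC lerB_dist.
have a0 : 0 <= a by exact: normr_ge0.
(* [powR_lip] wants bases at least 1; truncating from below at 1 does not widen the gap between [a]
   and [b]. *)
pose A : R := Num.max 1 a; pose B : R := Num.max 1 b.
have A1 : 1 <= A by rewrite le_max lexx.
have aA : a <= A by rewrite le_max lexx orbT.
have AB : A <= B by rewrite ge_max !le_max lexx xy orbT.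
have BA : B - A <= b - a.
  rewrite /B /A; move: xy; rewrite -/a -/b.
  by case: (leP 1 a); case: (leP 1 b); lra.
have := powR_lip A B n A1 AB qn.
rewrite -/A -/B.
have : A `^ (p - 1) <= B `^ (p - 1).
  by rewrite ge0_ler_powR// nnegrE; lra.
have : 0 <= B `^ (p - 1) by exact: powR_ge0.
move: (A `^ (p - 1)) (B `^ (p - 1)) => u v v0 uv h.
have nv : 0 <= n%:R * v by rewrite mulr_ge0.
have H1 : a * (v - u) <= n%:R * v * (b - a).
  apply: (@le_trans _ _ (A * (v - u))); first by rewrite ler_wpM2r// subr_ge0.
  by apply: (le_trans h); rewrite ler_wpM2l.
rewrite distrC ger0_norm; last first.
  rewrite subr_ge0; apply: (@le_trans _ _ (v * a)); first by rewrite ler_wpM2r.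
  by rewrite ler_wpM2l.
(* Since [v * b - u * a = v * (b - a) + a * (v - u)], the first term contributes 1 and the second,
   by [H1], contributes [n] to the constant [n.+1]. *)
apply: (@le_trans _ _ (n.+1%:R * (v * (b - a)))); last first.
  by rewrite !ler_wpM2l.
rewrite -natr1; nra.
Qed.

End cost.

(* [g x < a] iff [g (z k) + dist x (z k) < a] for some [k]. *)
Lemma measurable_fun_countable_dense {d} {T : measurableType d} {R : realType}
    {Z : countType} (z : Z -> T) (dist : T -> T -> R) (g : T -> R) :
  (forall k, measurable_fun setT (dist ^~ (z k))) ->
  (forall x e, 0 < e -> exists k, dist x (z k) < e) ->
  (forall x y, `|g x - g y| <= dist x y) ->
  measurable_fun setT g.
Proof.
move=> mdist zdense gdist _.
apply: (measurability _ (RGenInftyO.measurableE R)) => // _ [_ [a ->] <-].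
rewrite setTI [X in measurable X](_ : _ =
    \bigcup_k [set x | g (z k) + dist x (z k) < a]); last first.
  apply/seteqP; split => x /=.
    rewrite in_itv/= => gxa.
    (* Half the gap, because the distance enters twice: in [g (z k) <= g x + dist x (z k)] and in
       the set itself. *)
    have /(zdense x)[k xk] : 0 < (a - g x) / 2 by lra.
    exists k => //=.
    by have := gdist x (z k); rewrite ler_norml => /andP[]; lra.
  move=> [k _ /=]; rewrite in_itv/=.
  by have := gdist x (z k); rewrite ler_norml => /andP[]; lra.
apply: countable_bigcupT_measurable => // k.
rewrite -[X in measurable X]setTI.
have := @measurable_funD _ _ R setT _ _ (measurable_cst (g (z k))) (mdist k).
move=> /(_ measurableT `]-oo, a[%classic (measurable_itv _)).
by rewrite set_itvE.
Qed.

Lemma integrable_comp_pushforward {d d'} {X : measurableType d}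
    {Y : measurableType d'} {R : realType} (phi : X -> Y)
    (mu : {measure set X -> \bar R}) (f : Y -> \bar R) :
  measurable_fun setT phi ->
  (pushforward mu phi).-integrable setT f <->
    (measurable_fun setT f /\ mu.-integrable setT (f \o phi)).
Proof.
move=> mphi; split => [/integrableP[mf foo]|[mf ifphi]]; last first.
  exact: (integrable_pushforward mphi).
split => //; apply/integrableP; split; first exact: measurableT_comp.
move: foo; rewrite (ge0_integral_pushforward mphi)//.
exact: measurableT_comp.
Qed.

(** * Product measures on tuples: existence, uniqueness, marginals, Fubini *)

Section product_probability.
Context {R : realType}.
Implicit Types P Q : probability R R.

Definition tcons {n} (x : R * n.-tuple R) : n.+1.-tuple R :=
  [tuple of x.1 :: x.2].

Lemma measurable_tcons n : measurable_fun setT (@tcons n).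
Proof. by apply: measurable_cons. Qed.

HB.instance Definition _ n :=
  isMeasurableFun.Build _ _ _ _ (@tcons n) (@measurable_tcons n).

(** A concrete product measure, built by recursion so that Fubini can split off the first
    coordinate. The space of 0-tuples is a single point, whence the Dirac measure. *)
Fixpoint iprod P n : probability (n.-tuple R) R :=
  match n with
  | 0 => @dirac _ (0.-tuple R) [tuple] R
  | m.+1 => distribution (P \x iprod P m)%E (@tcons m)
  end.

Definition rect {n} (A : 'I_n -> set R) : set (n.-tuple R) :=
  [set x | forall i, A i (tnth x i)].

Lemma measurable_rect n (A : 'I_n -> set R) :
  (forall i, measurable (A i)) -> measurable (rect A).
Proof.
move=> mA; rewrite (_ : rect A =
    \big[setI/setT]_(i < n) ((@tnth n R)^~ i @^-1` A i)).
  apply: bigsetI_measurable => i _; rewrite -[X in measurable X]setTI.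
  exact: measurable_tnth.
rewrite -classical_sets.bigcap_seq; apply/seteqP; split=> x /= xA.
  by move=> i _; exact: xA.
by move=> i; apply: xA => /=; exact: mem_index_enum.
Qed.

(** [tcons] pulls a rectangle back to its first side times the rectangle of the remaining sides. *)
Lemma is_prod_measure_iprod P n : is_prod_measure P (iprod P n).
Proof.
elim: n => [|n ih] A mA.
  by rewrite big_ord0 /= diracE mem_set// => -[].
rewrite /= /distribution /pushforward.
rewrite (_ : _ @^-1` _ = A ord0 `*` rect (fun i => A (lift ord0 i))).
  rewrite product_measure1E//; last exact: measurable_rect.
  by rewrite big_ord_recl -ih.
apply/seteqP; split=> [x /= xA|x /= [xA0 xA] i].
  by split=> [|i]; [exact: (xA ord0)|have := xA (lift ord0 i); rewrite tnthS].
by case: (unliftP ord0 i) => [j|] ->; [rewrite tnthS; exact: xA|exact: xA0].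
Qed.

Lemma is_prod_measure_setT P n (mu : set (n.-tuple R) -> \bar R) :
  is_prod_measure P mu -> mu setT = 1%E.
Proof.
move=> /(_ (fun=> setT) (fun=> measurableT)).
rewrite (_ : [set x | _] = setT); last exact/seteqP.
by move=> ->; rewrite big1// => i _; exact: probability_setT.
Qed.

(** Rectangles are stable under intersection and generate the sigma-algebra of tuples, and both
    measures have total mass 1. *)
Lemma is_prod_measure_unique P n (mu nu : {measure set (n.-tuple R) -> \bar R}) :
  is_prod_measure P mu -> is_prod_measure P nu ->
  forall A, measurable A -> mu A = nu A.
Proof.
move=> muP nuP.
pose G := [set B | exists2 A : 'I_n -> set R,
  (forall i, measurable (A i)) & B = rect A].
have GT : G setT by exists (fun=> setT) => //; apply/seteqP.
have muG A : measurable A -> <<s G >> A.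
  apply: smallest_sub; first exact: smallest_sigma_algebra.
  rewrite -bigcup_seq => B [i _ [C mC <-]]; apply: sub_sigma_algebra.
  (* A generator constrains the single coordinate [i], so it is a rectangle whose other sides are
     full. *)
  exists (fun j => if j == i then C else setT); first by move=> j; case: ifP.
  rewrite setTI; apply/seteqP; split=> [x /= Cx j|x /(_ i)]; last by rewrite eqxx.
  by case: eqP => [->|].
move=> A /muG.
apply: (@g_sigma_algebra_measure_unique _ _ _ G _ (fun=> setT)) => //.
- by move=> _ [B mB ->]; exact: measurable_rect.
- by apply/seteqP; split=> // x _; exists 0%N.
- move=> _ _ [B mB ->] [C mC ->]; exists (fun i => B i `&` C i).
    by move=> i; exact: measurableI.
  apply/seteqP; split=> [x /= [Bx Cx] i|x /= BCx]; first by split.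
  by split=> i; have [] := BCx i.
- by move=> _ [B mB ->]; rewrite muP// nuP.
- by move=> _; rewrite (is_prod_measure_setT _ _ _ muP) ltry.
Qed.

(** The law of each coordinate under [mu] is [P]: the other sides of the rectangle are full and
    contribute factors 1. *)
Lemma integral_tnth P n (mu : {measure set (n.-tuple R) -> \bar R}) i
    (f : R -> \bar R) :
  is_prod_measure P mu -> P.-integrable setT f ->
  mu.-integrable setT (fun x => f (tnth x i)).
Proof.
move=> muP intf.
have mf : measurable_fun setT f by exact: measurable_int intf.
apply: (proj2 (proj1 (integrable_comp_pushforward _ mu f
  (measurable_tnth i)) _)).
apply/integrableP; split => //.
move/integrableP : intf => [_]; apply: le_lt_trans.
rewrite (eq_measure_integral P) => [//||mtnth A mA _].
  exact: measurable_tnth.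
rewrite /= /pushforward.
have -> : (@tnth n R)^~ i @^-1` A = rect (fun j => if j == i then A else setT).
  apply/seteqP; split=> [x /= Ax j|x /(_ i)]; last by rewrite eqxx.
  by case: eqP => [->|].
rewrite muP; last by move=> j; case: ifP.
rewrite (bigD1 i)//= eqxx big1 ?mule1// => j /negbTE ->.
exact: probability_setT.
Qed.

Lemma integral_iprodS P n (f : n.+1.-tuple R -> \bar R) :
  (iprod P n.+1).-integrable setT f ->
  (\int[iprod P n.+1]_x f x = \int[P]_x \int[iprod P n]_t f (tcons (x, t)))%E.
Proof.
move=> /(integrable_comp_pushforward _ _ _ (@measurable_tcons n))[mf intf].
rewrite (integral_pushforward (@measurable_tcons n))//.
by rewrite preimage_setT -(integral12_prod_meas1 intf).
Qed.

(** The real-valued integral is a [fine], which sends infinite values to 0; integrability of every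
    slice makes the inner [fine] faithful. *)
Lemma Rintegral_iprodS P n (f : n.+1.-tuple R -> R) :
  (iprod P n.+1).-integrable setT (EFin \o f) ->
  (forall x, (iprod P n).-integrable setT (fun t => (f (tcons (x, t)))%:E)) ->
  \int[iprod P n.+1]_x f x =
    \int[P]_x \int[iprod P n]_t f (tcons (x, t)).
Proof.
move=> intf intfx; congr fine; rewrite integral_iprodS//=.
apply: eq_integral => x _; rewrite fineK//.
exact: integrable_fin_num (intfx x).
Qed.

End product_probability.

(** * Integrability and comparison of integrals under a probability measure *)

Section probability_integral.
Context {d} {T : measurableType d} {R : realType} (P : probability T R).

(** [f] is dominated by the constant [|f o|], integrable for a finite measure, plus [G]. *)
Lemma integrable_dist_le (f G : T -> R) o :
  measurable_fun setT f -> P.-integrable setT (EFin \o G) ->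
  (forall x, `|f x - f o| <= G x) -> P.-integrable setT (EFin \o f).
Proof.
move=> mf intG fG.
have intG' : P.-integrable setT (fun x => (`|f o|)%:E + (G x)%:E)%E.
  by apply: integrableD => //; exact: finite_measure_integrable_cst.
apply: le_integrable intG' => //; first exact/measurable_EFinP.
move=> x _ /=; rewrite lee_fin.
have G0 : 0 <= G x by exact: le_trans (fG x).
rewrite [leRHS]ger0_norm ?addr_ge0// -lerBlDl.
exact: le_trans (lerB_dist _ _) (fG x).
Qed.

Lemma le_dist_Rintegral (f g : T -> R) (c : R) :
  P.-integrable setT (EFin \o f) -> P.-integrable setT (EFin \o g) ->
  (forall x, `|f x - g x| <= c) -> `|\int[P]_x f x - \int[P]_x g x| <= c.
Proof.
move=> intf intg fgc; rewrite -RintegralB//.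
have intfg : P.-integrable setT (EFin \o (fun x => f x - g x)).
  exact: (integrableB measurableT intf intg).
apply: (le_trans (le_normr_Rintegral _ intfg)) => //.
have -> : c = \int[P]_x c.
  by rewrite Rintegral_cst//= probability_setT mulr1.
apply: le_Rintegral => //.
- exact: integrable_norm intfg.
- exact: finite_measure_integrable_cst.
Qed.

End probability_integral.

(** * Functions that are Lipschitz for the additive cost *)

Section tuple_cost.
Context {R : realType} (p : R).
Hypothesis p1 : 1 <= p.

Definition cost_lip (C : R) {n} (g : n.-tuple R -> R) := forall x y,
  `|g x - g y| <= C * \sum_(k < n) cost p (tnth x k) (tnth y k).

Lemma measurable_cost_lip1 C (h : R -> R) :
  0 <= C -> (forall x y, `|h x - h y| <= C * cost p x y) ->
  measurable_fun setT h.
Proof.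
move=> C0 hC; apply: (measurable_fun_countable_dense (@ratr R)
  (fun x y => C * cost p x y)) => // [k|x e e0].
  by apply: measurable_funM => //; exact: measurable_cost.
(* Adding 1 keeps the denominator positive when [C = 0] and makes [C * (e / (C + 1)) < e] strict. *)
have d0 : 0 < e / (C + 1) by rewrite divr_gt0// ltr_wpDl.
have [k xk] := cost_dense p p1 x _ d0; exists k.
apply: (@le_lt_trans _ _ (C * (e / (C + 1)))); first by rewrite ler_wpM2l// ltW.
by rewrite mulrCA -[ltRHS]mulr1 ltr_pM2l// ltr_pdivrMr ?mul1r ?ltrDl ?ltr_wpDl.
Qed.

(** The countable dense set consists of the tuples of rationals, chosen coordinatewise with error
    [e / (C * n%:R + 1)]. *)
Lemma measurable_cost_lip C n (g : n.-tuple R -> R) :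
  0 <= C -> cost_lip C g -> measurable_fun setT g.
Proof.
move=> C0 gC.
apply: (measurable_fun_countable_dense (map_tuple (@ratr R))
  (fun x y => C * \sum_(k < n) cost p (tnth x k) (tnth y k))) => // [z|x e e0].
  apply: measurable_funM => //; apply: measurable_sum => i.
  exact: (measurableT_comp (measurable_cost p _) (measurable_tnth i)).
have d0 : 0 < e / (C * n%:R + 1) by rewrite divr_gt0// ltr_wpDl// mulr_ge0.
pose z := [tuple xchoose (cost_dense p p1 (tnth x i) _ d0) | i < n].
exists z; apply: (@le_lt_trans _ _ (C * \sum_(k < n) (e / (C * n%:R + 1)))).
  rewrite ler_wpM2l// ler_sum// => i _; rewrite tnth_map tnth_mktuple.
  by apply/ltW; exact: (xchooseP (cost_dense p p1 (tnth x i) _ d0)).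
rewrite sumr_const card_ord -[X in C * X]mulr_natl mulrA mulrCA -[ltRHS]mulr1.
rewrite ltr_pM2l// ltr_pdivrMr ?mul1r ?ltrDl//.
by rewrite ltr_wpDl// mulr_ge0.
Qed.

(** Comparison with the zero tuple bounds the growth of [g] by a sum of one-coordinate costs, each
    integrable because every marginal is [P]. *)
Lemma integrable_cost_lip (P : probability R R) C n (g : n.-tuple R -> R) :
  0 <= C -> P.-integrable setT (EFin \o (cost p ^~ 0)) ->
  cost_lip C g -> (iprod P n).-integrable setT (EFin \o g).
Proof.
move=> C0 intP gC.
pose G (x : n.-tuple R) : R := C * \sum_(k < n) cost p (tnth x k) 0.
apply: (integrable_dist_le _ _ G (nseq_tuple n 0)).
- exact: measurable_cost_lip C0 gC.
- rewrite (_ : EFin \o G =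
      (fun x => C%:E * \sum_(k < n) (cost p (tnth x k) 0)%:E)%E); last first.
    by apply/funext => x; rewrite /G /= EFinM sumEFin.
  apply: integrableZl => //; apply: integrable_sum => // i _.
  exact: (integral_tnth P n _ i _ (is_prod_measure_iprod P n) intP).
- move=> x; apply: (le_trans (gC _ _)).
  by rewrite ler_wpM2l// ler_sum// => i _; rewrite tnth_nseq.
Qed.

Lemma integrable_cost_lip1 (P : probability R R) C (h : R -> R) :
  0 <= C -> P.-integrable setT (EFin \o (cost p ^~ 0)) ->
  (forall x y, `|h x - h y| <= C * cost p x y) ->
  P.-integrable setT (EFin \o h).
Proof.
move=> C0 intP hC.
apply: (integrable_dist_le _ _ (fun x => C * cost p x 0) 0) => //.
  apply: (measurable_cost_lip1 C) => //.
exact: (integrableZl measurableT C intP).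
Qed.

End tuple_cost.

(** * Exchanging [P] for [Q] one coordinate at a time *)

Section telescope.
Context {R : realType} (p : R) (P Q : probability R R) (D : R).
Hypotheses (p1 : 1 <= p)
  (intP : P.-integrable setT (EFin \o (cost p ^~ 0)))
  (intQ : Q.-integrable setT (EFin \o (cost p ^~ 0)))
  (PQ : forall psi, FMclass p psi ->
     `|\int[P]_x psi x - \int[Q]_x psi x| <= D).

Let cost_lip_tcons C n (g : n.+1.-tuple R -> R) x :
  0 <= C -> cost_lip p C g -> cost_lip p C (fun t => g (tcons (x, t))).
Proof.
move=> C0 gC t u; apply: (le_trans (gC _ _)); rewrite big_ord_recl costxx add0r.
by rewrite ler_wpM2l// ler_sum// => i _; rewrite !tnthS.
Qed.

Lemma Rintegral_cost_lip C n (g : n.-tuple R -> R) :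
  0 < C -> cost_lip p C g ->
  `|\int[iprod P n]_x g x - \int[iprod Q n]_x g x| <= C * D *+ n.
Proof.
move=> C0; elim: n g => [|n ih] g gC.
  have [c ->] : exists c, g = cst c.
    by exists (g [tuple]); apply/funext => x; rewrite (tuple0 x).
  rewrite !Rintegral_cst//=.
  by rewrite /= subrr normr0.
have C0' := ltW C0.
have gCx x := cost_lip_tcons C n g x C0' gC.
have iP m f := integrable_cost_lip p p1 P C m f C0' intP.
have iQ m f := integrable_cost_lip p p1 Q C m f C0' intQ.
rewrite !Rintegral_iprodS;
  try by [exact: iP|exact: iQ|move=> x; exact: iP|move=> x; exact: iQ].
pose hP x := \int[iprod P n]_t g (tcons (x, t)).
pose hQ x := \int[iprod Q n]_t g (tcons (x, t)).
(* The two tuples share the tail [t], so only the first coordinate contributes to the cost. *)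
have hlip (P' : probability R R) :
    P'.-integrable setT (EFin \o (cost p ^~ 0)) -> forall x y,
    `|\int[iprod P' n]_t g (tcons (x, t)) - \int[iprod P' n]_t g (tcons (y, t))|
      <= C * cost p x y.
  move=> intP' x y; have iP' f := integrable_cost_lip p p1 P' C n f C0' intP'.
  apply: le_dist_Rintegral; [exact: iP'|exact: iP'|move=> t].
  apply: (le_trans (gC _ _)).
  rewrite ler_pM2l// big_ord_recl big1 ?addr0// => i _.
  by rewrite !tnthS costxx.
have hPlip := hlip _ intP; have hQlip := hlip _ intQ.
have ihP := integrable_cost_lip1 p p1 P C hP C0' intP hPlip.
(* The intermediate term integrates [hP], which is built from [P], against [Q]. *)
have ihPQ := integrable_cost_lip1 p p1 Q C hP C0' intQ hPlip.
have ihQ := integrable_cost_lip1 p p1 Q C hQ C0' intQ hQlip.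
rewrite -/hP -/hQ -(subrKA (\int[Q]_x hP x)) mulrS (le_trans (ler_normD _ _))//.
apply: lerD; last by apply: le_dist_Rintegral => // x; exact: ih.
(* The first coordinate accounts for one [C * D]: rescaling by [C^-1] makes [hP] a test function,
   for which [D] is the bound. *)
have /PQ : FMclass p (fun x => C^-1 * hP x).
  move=> x y; rewrite -mulrBr normrM gtr0_norm ?invr_gt0//.
  by rewrite mulrC ler_pdivrMr// mulrC; exact: hPlip.
rewrite !RintegralZl// -mulrBr normrM gtr0_norm ?invr_gt0//.
by rewrite mulrC ler_pdivrMr// mulrC.
Qed.

End telescope.

(** * Moments and finiteness of the Fortet-Mourier metric *)

Section FM_metric.
Context {R : realType} (p : R).
Hypothesis p1 : 1 <= p.
Implicit Types P Q : probability R R.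

Let FMclass_lip psi : FMclass p psi ->
  forall x y : R, `|psi x - psi y| <= 1 * cost p x y.
Proof. by move=> psip x y; rewrite mul1r; exact: psip. Qed.

(** [FMclass] does not mention measurability; the Lipschitz condition provides it. *)
Lemma measurable_FMclass psi : FMclass p psi -> measurable_fun setT psi.
Proof. by move=> /FMclass_lip; exact: measurable_cost_lip1. Qed.

Lemma integral_dirac_FMclass psi : FMclass p psi ->
  (\int[@dirac _ R 0%R R]_x (psi x)%:E)%E = (psi 0)%:E.
Proof.
move=> /measurable_FMclass mpsi.
rewrite integral_dirac//; last exact/measurable_EFinP.
by rewrite diracT mul1e.
Qed.

(** The test function [psi] is nonnegative and vanishes at 0, so its integral equals its discrepancy
    with the Dirac measure, which the finite [dFM] bounds. *)
Lemma integrable_Pp P : Pp p P -> P.-integrable setT (EFin \o (cost p ^~ 0)).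
Proof.
move=> Pfin; have [K K0 costK] := cost0_lip p p1.
pose psi x := K^-1 * cost p x 0.
have psip : FMclass p psi.
  move=> x y; rewrite /psi -mulrBr normrM gtr0_norm ?invr_gt0//.
  by rewrite mulrC ler_pdivrMr// mulrC; exact: costK.
have psi0 x : 0 <= psi x by rewrite mulr_ge0 ?invr_ge0 ?(ltW K0)//; exact: cost_ge0.
have intpsi : P.-integrable setT (EFin \o psi).
  apply/integrableP; split.
    by apply/measurable_EFinP; exact: measurable_FMclass psip.
  apply: le_lt_trans Pfin.
  have : (`|\int[P]_x (psi x)%:E - \int[@dirac _ R 0%R R]_x (psi x)%:E| <=
      dFM p P (@dirac _ R 0%R R))%E.
    by apply: ereal_sup_ubound; exists psi.
  rewrite integral_dirac_FMclass// {2}/psi costxx mulr0 sube0.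
  rewrite gee0_abs; last by apply: integral_ge0 => x _; rewrite lee_fin.
  rewrite [X in (_ <= _ -> X <= _)%E](_ : _ = \int[P]_x (psi x)%:E)%E//.
  by apply: eq_integral => x _; rewrite /= ger0_norm.
rewrite (_ : EFin \o _ = (fun x => K%:E * (EFin \o psi) x)%E).
  exact: (integrableZl measurableT K intpsi).
by apply/funext => x /=; rewrite -EFinM mulVKf// gt_eqF.
Qed.

Lemma integrable_FMclass P psi : Pp p P -> FMclass p psi ->
  P.-integrable setT (EFin \o psi).
Proof.
move=> /integrable_Pp intP /FMclass_lip.
exact: integrable_cost_lip1.
Qed.

Lemma dFM_ge0 (mu nu : set R -> \bar R) : (0 <= dFM p mu nu)%E.
Proof.
apply: (@le_trans _ _ `|\int[mu]_x (cst 0 x)%:E - \int[nu]_x (cst 0 x)%:E|%E) => //.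
apply: ereal_sup_ubound; exists (cst 0) => // x y.
by rewrite /= subrr normr0; exact: cost_ge0.
Qed.

(** Triangle inequality through the Dirac measure at 0, for each test function. *)
Lemma dFM_Pp_lty P Q : Pp p P -> Pp p Q -> (dFM p P Q < +oo)%E.
Proof.
move=> Pp1 Qp1.
apply: (@le_lt_trans _ _ (dFM p P (@dirac _ R 0%R R) + dFM p Q (@dirac _ R 0%R R))%E);
  last exact: lte_add_pinfty.
apply: ge_ereal_sup => _ [psi psip <-].
have dist0 P' : Pp p P' -> (`|\int[P']_x (psi x)%:E - (psi 0)%:E| <=
    dFM p P' (@dirac _ R 0%R R))%E.
  move=> Pp'; rewrite -integral_dirac_FMclass//.
  by apply: ereal_sup_ubound; exists psi.
(* Both integrals are finite, so the extended differences reduce to real ones. *)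
have intP := integrable_fin_num measurableT (integrable_FMclass _ _ Pp1 psip).
have intQ := integrable_fin_num measurableT (integrable_FMclass _ _ Qp1 psip).
apply: le_trans (leeD (dist0 _ Pp1) (dist0 _ Qp1)).
move: intP intQ => /=; case: (integral _ _ _) => // a _.
case: (integral _ _ _) => // b _.
rewrite /= lee_fin -[a - b](subrKA (psi 0)) -opprB (distrC b).
exact: ler_normD.
Qed.

End FM_metric.

(** As the Lipschitz hypothesis concerns the given [N] only, the fixed-[N] and all-[N] claims are
    both covered. At [p = 1] the bound is [L%:E * dK P Q] by definition of [dK]. *)
Theorem theorem2 (R : realType) (p : R) (rho : (set R -> \bar R) -> R)
    (M : set (probability R R)) (L : R) :
  1 <= p -> M `<=` Pp p -> 0 < L ->
  forall N : nat, (0 < N)%N ->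
  (forall xi xi' : N.-tuple R,
     `|rhohat rho xi - rhohat rho xi'| <=
       L / N%:R * \sum_(k < N) (cp p (tnth xi k) (tnth xi' k) *
                                `|tnth xi k - tnth xi' k|)) ->
  forall P Q : probability R R, M P -> M Q ->
  forall muP muQ : {measure set (N.-tuple R) -> \bar R},
    is_prod_measure P muP -> is_prod_measure Q muQ ->
    (dK (pushforward muP (@rhohat R rho N)) (pushforward muQ (@rhohat R rho N))
       <= L%:E * dFM p P Q)%E /\
    (L%:E * dFM p P Q < +oo)%E.
Proof.
move=> p1 Mp L0 N N0 rhoL P Q MP MQ muP muQ muPE muQE.
have PpP := Mp _ MP; have PpQ := Mp _ MQ.
have intP := integrable_Pp p p1 P PpP; have intQ := integrable_Pp p p1 Q PpQ.
have dPQ := dFM_Pp_lty p p1 P Q PpP PpQ.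
have dPQfin : (dFM p P Q \is a fin_num)%E by rewrite ge0_fin_numE// dFM_ge0.
split; last by rewrite lte_mul_pinfty// lee_fin ltW.
have C0 : 0 < L / N%:R by rewrite divr_gt0// ltr0n.
have mrho : measurable_fun setT (@rhohat R rho N).
  exact: (measurable_cost_lip p p1 _ _ _ (ltW C0) rhoL).
apply: ge_ereal_sup => _ [psi psi1 <-].
have mpsi := measurable_FMclass 1 (lexx 1) psi psi1.
(* For [psi] the weight has exponent 0, hence equals 1, and composing keeps the constant. *)
have lip : cost_lip p (L / N%:R) (psi \o @rhohat R rho N).
  move=> x y /=; apply: le_trans (rhoL x y); apply: (le_trans (psi1 _ _)).
  by rewrite /cp subrr powRr0 mul1r.
(* Change of variables along [rhohat], with [mu] replaced by [iprod] through uniqueness of the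
   product measure. *)
have transfer (P' : probability R R) (mu : {measure set (N.-tuple R) -> \bar R}) :
    P'.-integrable setT (EFin \o (cost p ^~ 0)) -> is_prod_measure P' mu ->
    (\int[pushforward mu (@rhohat R rho N)]_x (psi x)%:E)%E =
    (\int[iprod P' N]_x psi (rhohat rho x))%:E.
  move=> intP' muE.
  have int := integrable_cost_lip p p1 P' _ _ _ (ltW C0) intP' lip.
  rewrite /Rintegral fineK; last exact: integrable_fin_num int.
  have mpsiE : measurable_fun setT (EFin \o psi) by exact/measurable_EFinP.
  rewrite -[RHS](integral_pushforward mrho mpsiE (D := setT) int)//.
  apply: eq_measure_integral => // A mA _.
  apply: (is_prod_measure_unique P') => //; first exact: is_prod_measure_iprod.
  by rewrite -[X in measurable X]setTI; exact: mrho.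
rewrite (transfer P)// (transfer Q)// -EFinD abse_EFin -(fineK dPQfin) -EFinM lee_fin.
(* Each of the [N] coordinates contributes [L / N%:R] times the metric, which plays the role of
   [D]. *)
have -> : L * fine (dFM p P Q) = L / N%:R * fine (dFM p P Q) *+ N.
  by rewrite -mulr_natr mulrAC divfK// pnatr_eq0 -lt0n.
apply: (Rintegral_cost_lip p) => // phi phip.
have iphi P' : Pp p P' -> P'.-integrable setT (EFin \o phi).
  by move=> /(integrable_FMclass p p1)-/(_ _ phip).
rewrite -lee_fin fineK//; apply: ereal_sup_ubound; exists phi => //.
rewrite -[RHS]abse_EFin EFinB /Rintegral !fineK//.
- exact: (integrable_fin_num measurableT (iphi _ PpQ)).
- exact: (integrable_fin_num measurableT (iphi _ PpP)).
Qed.
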